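(* Let $G=(N,M_0,\mathcal{M}_F)$ be a bounded plant, let $\pi=(T_E,T_I)$ be a basis partition of the transition set of $N$, and let $\mathcal{B}_M$ be the minimax basis reachability graph (minimax-BRG) of $\langle N,M_0\rangle$ with respect to $\pi$. Then $G$ is nonblocking if and only if $\mathcal{B}_M$ is unobstructed and every dead marking in $R(N,M_0)$ belongs to $\mathcal{M}_F$.
   Context: **Petri nets.** A Petri net is $N=(P,T,Pre,Post)$ with a finite set $P$ of $m$ places, a finite set $T$ of transitions, and functions $Pre,Post:P\times T\to\mathbb{N}$ ($\mathbb{N}=\{0,1,2,\dots\}$); $C=Post-Pre$, and $A(\cdot,t)$ is the column of a matrix $A$ at $t$. A marking is a vector $M\in\mathbb{N}^m$. Transition $t$ is enabled at $M$ if $M\ge Pre(\cdot,t)$ componentwise, and its firing yields $M'=M+C(\cdot,t)$, written $M[t\rangle M'$. This extends to finite sequences $\sigma\in T^*$ (with $M[\varepsilon\rangle M$ for the empty sequence): $M[\sigma\rangle M'$; $M[\sigma\rangle$ means $\sigma$ can be fired at $M$. $R(N,M)$ is the set of markings reachable from $M$. A marked net is a pair $\langle N,M_0\rangle$ with initial marking $M_0$; it is bounded if there is $k\in\mathbb{N}$ with $M(p)\le k$ for all $M\in R(N,M_0)$, $p\in P$. A marking is dead if no transition is enabled at it. **Plants.** A plant $G=(N,M_0,\mathcal{M}_F)$ is a marked net together with a set $\mathcal{M}_F$ of final markings, which is either a finite subset of $R(N,M_0)$ or a set of the form $\{M\in\mathbb{N}^m\mid \mathbf{w}^T M\le k\}$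 with $\mathbf{w}\in\mathbb{Z}^m$, $k\in\mathbb{Z}$. It is bounded if $\langle N,M_0\rangle$ is. A marking $M\in R(N,M_0)$ is nonblocking if $R(N,M)\cap\mathcal{M}_F\ne\emptyset$, and blocking otherwise; $G$ is nonblocking if all markings in $R(N,M_0)$ are nonblocking. **Basis partitions.** A basis partition is a pair $\pi=(T_E,T_I)$ with $T=T_E\cup T_I$ disjoint (explicit and implicit transitions) such that the $T_I$-induced sub-net (same places, only the transitions in $T_I$, with $Pre,Post$ restricted) has no directed cycle in its underlying digraph (arcs $p\to t$ when $Pre(p,t)>0$, $t\to p$ when $Post(p,t)>0$). Let $n_I=|T_I|$ and let $C_I$ be the incidence matrix of this sub-net. For $\sigma\in T_I^*$, $\varphi(\sigma)\in\mathbb{N}^{n_I}$ is the vector counting occurrences of each transition in $\sigma$. **Explanations.** For a marking $M$ and $t\in T_E$: $\Sigma(M,t)=\{\sigma\in T_I^*\mid M[\sigma\rangle M',\ M'\ge Pre(\cdot,t)\}$; $\Sigma_{\min}(M,t)$ (resp. $\Sigma_{\max}(M,t)$) is the set of $\sigma\in\Sigma(M,t)$ for which there is no $\sigma'\in\Sigma(M,t)$ with $\varphi(\sigma')\le\varphi(\sigma)$ (resp. $\ge$) componentwise and $\varphi(\sigma')\neq\varphi(\sigma)$; $Y_{\min}(M,t)=\varphi(\Sigma_{\min}(M,t))$, $Y_{\max}(M,t)=\varphi(\Sigma_{\max}(M,t))$. **Minimax basis markings and minimax-BRG.** The set $\mathcal{M}_{B_M}$ of minimax basis markings is the smallest set such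 that $M_0\in\mathcal{M}_{B_M}$, and whenever $M\in\mathcal{M}_{B_M}$, $t\in T_E$ and $\mathbf{y}\in Y_{\min}(M,t)\cup Y_{\max}(M,t)$, then $M+C_I\mathbf{y}+C(\cdot,t)\in\mathcal{M}_{B_M}$. For a bounded marked net, the minimax-BRG is the finite automaton $\mathcal{B}_M$ with state set $\mathcal{M}_{B_M}$, initial state $M_0$, events the pairs $(t,\mathbf{y})\in T_E\times\mathbb{N}^{n_I}$ labelling its transitions, and transition relation $\Delta_M=\{(M_1,(t,\mathbf{y}),M_2)\mid t\in T_E,\ \mathbf{y}\in Y_{\min}(M_1,t)\cup Y_{\max}(M_1,t),\ M_2=M_1+C_I\mathbf{y}+C(\cdot,t)\}$, extended to finite (possibly empty) sequences of events. **Unobstructedness.** For $M_b\in\mathcal{M}_{B_M}$ the implicit reach is $R_I(M_b)=\{M\in\mathbb{N}^m\mid \exists\sigma\in T_I^*:\ M_b[\sigma\rangle M\}$. Let $\mathcal{M}_{i_{co}}=\{M_b\in\mathcal{M}_{B_M}\mid R_I(M_b)\cap\mathcal{M}_F\ne\emptyset\}$. $\mathcal{B}_M$ is unobstructed if for every $M_b\in\mathcal{M}_{B_M}$ there exist $M_b'\in\mathcal{M}_{i_{co}}$ and a finite sequence $\sigma^+$ of events with $(M_b,\sigma^+,M_b')\in\Delta_M$.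
   Formalization: The formal theorem additionally assumes that no implicit transition is isolated (empty preset and empty postset); without this the claim fails, since such a transition leaves no maximal explanations and no dead markings. *)

(* Defs.v *)
From mathcomp Require Import all_boot all_order all_algebra.

Set Implicit Arguments.
Unset Strict Implicit.
Unset Printing Implicit Defensive.

Import Order.TTheory GRing.Theory Num.Theory.

Section PetriNets.
Variables P T : finType.

Record petri_net := PetriNet { pre : P -> T -> nat; post : P -> T -> nat }.

Definition marking := {ffun P -> nat}.

Definition incidence (N : petri_net) (p : P) (t : T) : int :=
  ((post N p t)%:Z - (pre N p t)%:Z)%R.

Definition enabled (N : petri_net) (M : marking) (t : T) : Prop :=
  forall p, pre N p t <= M p.

Definition fire (N : petri_net) (M : marking) (t : T) (M' : marking) : Prop :=
  enabled N M t /\ forall p, ((M' p)%:Z = (M p)%:Z + incidence N p t)%R.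

Fixpoint fires (N : petri_net) (M : marking) (s : seq T) (M' : marking) : Prop :=
  if s is t :: s' then exists2 M1, fire N M t M1 & fires N M1 s' M' else M = M'.

Definition reachable (N : petri_net) (M M' : marking) : Prop :=
  exists s : seq T, fires N M s M'.

Definition bounded_net (N : petri_net) (M0 : marking) : Prop :=
  exists k : nat, forall M, reachable N M0 M -> forall p, M p <= k.

Definition dead (N : petri_net) (M : marking) : Prop :=
  forall t, ~ enabled N M t.

(* An isolated transition is enabled at every marking and firing it changes
   nothing. If one is implicit, every explanation can be lengthened by it, so
   there are no maximal explanations, and no marking is dead. *)
Definition isolated (N : petri_net) (t : T) : Prop :=
  forall p, pre N p t = 0 /\ post N p t = 0.

Definition net_arc (N : petri_net) : rel (P + T) := fun x y =>
  match x, y with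
  | inl p, inr t => 0 < pre N p t
  | inr t, inl p => 0 < post N p t
  | _, _ => false
  end.

(* [cycle e [::]] holds by convention, hence the conclusion [c = [::]]. *)
Definition acyclic_net (N : petri_net) : Prop :=
  forall c : seq (P + T), cycle (net_arc N) c -> c = [::].

Definition finite_final (N : petri_net) (M0 : marking) (F : marking -> Prop) :=
  exists2 s : seq marking,
    forall M, F M <-> M \in s & forall M, F M -> reachable N M0 M.

Definition linear_final (F : marking -> Prop) :=
  exists (w : P -> int) (k : int),
    forall M, F M <-> (\sum_p w p * (M p)%:Z <= k)%R.

Record plant := Plant {
  plant_net : petri_net;
  plant_init : marking;
  plant_final : marking -> Prop;
  plant_finalP :
    finite_final plant_net plant_init plant_final \/ linear_final plant_final
}.

Definition bounded_plant (G : plant) : Prop :=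
  bounded_net (plant_net G) (plant_init G).

Definition nonblocking_marking (G : plant) (M : marking) : Prop :=
  exists2 M', reachable (plant_net G) M M' & plant_final G M'.

Definition nonblocking (G : plant) : Prop :=
  forall M, reachable (plant_net G) (plant_init G) M -> nonblocking_marking G M.

Definition trans_in (A : {set T}) : finType := {t : T | t \in A}.

End PetriNets.

Definition induced_subnet (P T : finType) (N : petri_net P T) (A : {set T}) :
    petri_net P (trans_in A) :=
  PetriNet (fun p t => pre N p (val t)) (fun p t => post N p (val t)).

Definition basis_partition (P T : finType) (N : petri_net P T)
    (TE TI : {set T}) : Prop :=
  [/\ TE :|: TI = [set: T], [disjoint TE & TI]
    & acyclic_net (induced_subnet N TI)].

(* [states] selects the states inside the carrier [S]; [run] is the extension
   of the transition relation to finite event sequences. *)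
Record automaton (S E : Type) := Automaton {
  states : S -> Prop;
  initial : S;
  delta : S -> E -> S -> Prop
}.

Fixpoint run (S E : Type) (A : automaton S E) (x : S) (s : seq E) (z : S) : Prop :=
  if s is e :: s' then exists2 y, delta A x e y & run A y s' z else x = z.

Section MinimaxBRG.
Variables (P T : finType) (N : petri_net P T) (TE TI : {set T}).

Definition firing_vector := {ffun trans_in TI -> nat}.

Definition vec_le (y y' : firing_vector) : Prop := forall t, y t <= y' t.

Definition parikh (s : seq (trans_in TI)) : firing_vector :=
  [ffun t => count_mem t s].

Definition explanation (M : marking P) (t : trans_in TE)
    (s : seq (trans_in TI)) : Prop :=
  exists2 M', fires N M (map val s) M' & enabled N M' (val t).

Definition min_explanation (M : marking P) (t : trans_in TE)
    (s : seq (trans_in TI)) : Prop :=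
  explanation M t s /\
  ~ exists s', [/\ explanation M t s', vec_le (parikh s') (parikh s)
                 & parikh s' <> parikh s].

Definition max_explanation (M : marking P) (t : trans_in TE)
    (s : seq (trans_in TI)) : Prop :=
  explanation M t s /\
  ~ exists s', [/\ explanation M t s', vec_le (parikh s) (parikh s')
                 & parikh s' <> parikh s].

Definition Ymin (M : marking P) (t : trans_in TE) (y : firing_vector) : Prop :=
  exists2 s, min_explanation M t s & parikh s = y.

Definition Ymax (M : marking P) (t : trans_in TE) (y : firing_vector) : Prop :=
  exists2 s, max_explanation M t s & parikh s = y.

Definition event : Type := (trans_in TE * firing_vector)%type.

Definition minimax_step (M1 : marking P) (e : event) (M2 : marking P) : Prop :=
  (Ymin M1 e.1 e.2 \/ Ymax M1 e.1 e.2) /\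
  forall p, ((M2 p)%:Z = (M1 p)%:Z
    + (\sum_(t : trans_in TI) incidence (induced_subnet N TI) p t * (e.2 t)%:Z)
    + incidence N p (val e.1))%R.

(* Explanations are firable, so the vector M1 + C_I y + C(., t) of
   [minimax_step] is nonnegative and the marking M2 always exists. *)
Inductive minimax_basis (M0 : marking P) : marking P -> Prop :=
| minimax_basis_init : minimax_basis M0 M0
| minimax_basis_step M1 e M2 :
    minimax_basis M0 M1 -> minimax_step M1 e M2 -> minimax_basis M0 M2.

Definition minimax_BRG (M0 : marking P) : automaton (marking P) event :=
  Automaton (minimax_basis M0) M0
    (fun M1 e M2 => minimax_basis M0 M1 /\ minimax_step M1 e M2).

Definition implicit_reach (Mb M : marking P) : Prop :=
  exists s : seq (trans_in TI), fires N Mb (map val s) M.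

(* The states of [B] whose implicit reach meets [F]. *)
Definition i_coreachable (F : marking P -> Prop)
    (B : automaton (marking P) event) (Mb : marking P) : Prop :=
  states B Mb /\ exists2 M, implicit_reach Mb M & F M.

Definition unobstructed (F : marking P -> Prop)
    (B : automaton (marking P) event) : Prop :=
  forall Mb, states B Mb ->
    exists2 Mb', i_coreachable F B Mb' & exists s, run B Mb s Mb'.

End MinimaxBRG.

(* Main.v *)
(**
   In an acyclic net the state equation is also sufficient: if [M + C y] is a
   nonnegative marking, then [y] can be fired from [M], starting with a
   transition of its support that lies furthest upstream.
   Hence a firing sequence can be followed by minimal explanations, the implicit
   transitions left over at each explicit one being postponed, and every
   reachable [M] lies in the implicit reach of some basis marking [Mb].
   If [M] enables an explicit transition [t], the implicit sequence from [Mb] to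
   [M] explains [t] at [Mb]; take a maximal explanation dominating it.
   By the state equation, its remaining part can be fired from [M] and followed
   by [t], so [M] reaches a basis marking, from which unobstructedness leads to
   a final marking.
   Otherwise [M] is dead or enables an implicit transition. The latter can happen
   only finitely often in a row: boundedness forbids nonisolated transitions
   without input places, and then acyclicity provides a weighted token count
   that decreases at each implicit firing; the same count bounds explanations,
   so maximal ones exist.
*)
Require Import Defs.
From mathcomp Require Import all_boot all_order all_algebra zify.
From Stdlib Require Import Classical.

Set Implicit Arguments.
Unset Strict Implicit.
Unset Printing Implicit Defensive.

Import GRing.Theory Num.Theory.

(** * Firing sequences and the state equation *)

Section Nets.
Variables (P T : finType) (N : petri_net P T).
Implicit Types (M : marking P) (s : seq T).

Lemma enabled_fire M t : enabled N M t -> exists M', fire N M t M'.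
Proof.
move=> en; exists [ffun p => M p - pre N p t + post N p t].
split=> // p; rewrite ffunE /incidence; have := en p; lia.
Qed.

Lemma fires_cat M s1 s2 M' :
  fires N M (s1 ++ s2) M' <-> exists2 M1, fires N M s1 M1 & fires N M1 s2 M'.
Proof.
elim: s1 M => [|t s1 IH] M /=; first by split=> [|[M1 ->]] //; exists M.
split=> [[M2 f2 /IH[M1 f1 f]]|[M1 [M2 f2 f1] f]].
  by exists M1 => //; exists M2.
by exists M2 => //; apply/IH; exists M1.
Qed.

Lemma fires1 M t M' : fires N M [:: t] M' <-> fire N M t M'.
Proof. by split=> /= [[M1 f <-]|f] //; exists M'. Qed.

Lemma reachable_refl M : reachable N M M.
Proof. by exists [::]. Qed.

Lemma reachable_trans M2 M1 M3 :
  reachable N M1 M2 -> reachable N M2 M3 -> reachable N M1 M3.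
Proof. by move=> [s f] [s' f']; exists (s ++ s'); apply/fires_cat; exists M2. Qed.

Lemma fire_reachable M t M' : fire N M t M' -> reachable N M M'.
Proof. by move=> f; exists [:: t]; apply/fires1. Qed.

Definition state_change (p : P) (y : T -> nat) : int :=
  (\sum_t incidence N p t * (y t)%:Z)%R.

Lemma state_changeD p y1 y2 :
  state_change p (fun t => y1 t + y2 t) = (state_change p y1 + state_change p y2)%R.
Proof.
rewrite /state_change -big_split /=; apply: eq_bigr => t _.
by rewrite PoszD mulrDr.
Qed.

Lemma state_change1 p t : state_change p (fun t' => t == t') = incidence N p t.
Proof.
rewrite /state_change (bigD1 t) //= eqxx mulr1 big1 ?addr0 // => t' ne.
by rewrite eq_sym (negPf ne) mulr0.
Qed.

Lemma eq_state_change p y1 y2 : y1 =1 y2 -> state_change p y1 = state_change p y2.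
Proof. by move=> e; apply: eq_bigr => t _; rewrite e. Qed.

Lemma fires_state M s M' p : fires N M s M' ->
  ((M' p)%:Z = (M p)%:Z + state_change p (fun t => count_mem t s))%R.
Proof.
elim: s M => [|t s IH] M /=.
  by move->; rewrite /state_change big1 ?addr0 // => t _; rewrite mulr0.
by case=> M1 [_ e] /IH->; rewrite e state_changeD state_change1 -addrA.
Qed.

(** A nonisolated transition without input places could fire forever from [M0], adding tokens to one
    of its output places each time; [k.+1] firings already exceed the bound [k]. *)
Lemma bounded_pre_nonempty M0 t : bounded_net N M0 -> ~ isolated N t ->
  exists p, 0 < pre N p t.
Proof.
move=> [k bound] iso; apply: NNPP => nopre; case: iso => p.
have pre0 q : pre N q t = 0.
  by case: (posnP (pre N q t)) => // lt; case: nopre; exists q.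
split=> //; case: (posnP (post N p t)) => // post_gt0.
have [M' f] : exists M', fires N M0 (nseq k.+1 t) M'.
  elim: k.+1 M0 {bound} => [|n IH] M0; first by exists M0.
  have [|M1 f1] := @enabled_fire M0 t; first by move=> q; rewrite pre0.
  by have [M' f] := IH M1; exists M', M1.
have le_k : M' p <= k by apply: bound; exists (nseq k.+1 t).
move: le_k; have := fires_state p f.
have -> : state_change p (fun t' => count_mem t' (nseq k.+1 t))
          = (incidence N p t * k.+1%:Z)%R.
  rewrite /state_change (bigD1 t) //= count_nseq /= eqxx mul1n big1 ?addr0 // => t' ne.
  by rewrite count_nseq /= eq_sym (negPf ne) mulr0.
rewrite /incidence pre0; nia.
Qed.

(** * Acyclic nets *)

Section Acyclic.
Hypothesis acN : acyclic_net N.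

(** A topological rank: in an acyclic net it strictly decreases along every arc. *)
Definition height (x : P + T) : nat := #|connect (net_arc N) x|.

Lemma height_arc x y : net_arc N x y -> height y < height x.
Proof.
move=> xy; apply: proper_card; apply/properP; split.
  by apply/subsetP => z; apply: connect_trans; apply: connect1.
exists x; first exact: connect0.
(* A path back from [y] to [x] would close a cycle with the arc. *)
apply/negP => /connectP[c yc xE].
suff: y :: c = [::] by [].
by apply: acN; rewrite /= rcons_path yc -xE.
Qed.

Lemma acyclic_fires M M' (y : T -> nat) :
  (forall p, ((M' p)%:Z = (M p)%:Z + state_change p y)%R) ->
  exists2 s, fires N M s M' & forall t, count_mem t s = y t.
Proof.
elim: {y}_.+1 {-2}y M (ltnSn (\sum_t y t)) => // n IH y M le_n MM'.
case: (pickP (fun t => 0 < y t)) => [t0 yt0|y0]; last first.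
  exists [::] => [|t]; last by rewrite /=; case: (y t) (y0 t).
  apply/ffunP => p; have := MM' p; rewrite /state_change big1; first by lia.
  by move=> t _; have := y0 t; case: (y t) => //; rewrite mulr0.
(* No transition of the support feeds an input place of a highest one, so the tokens it consumes
   must already be present in [M]. *)
case: (@arg_maxnP _ t0 (fun t => 0 < y t) (fun t => height (inr t)) yt0).
move=> t yt tmax.
pose y' t' := y t' - (t == t').
have yE t' : y t' = (t == t') + y' t'.
  by rewrite /y'; case: eqP => [<-|] /=; lia.
have en : enabled N M t.
  move=> p; case: (posnP (pre N p t)) => [->//|pre_gt0].
  have nopost t' : 0 < y t' -> post N p t' = 0.
    move=> yt'; case: (posnP (post N p t')) => // post_gt0.
    have h1 := @height_arc (inl p) (inr t) pre_gt0.
    have h2 := @height_arc (inr t') (inl p) post_gt0.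
    have := tmax t' yt'; lia.
  have := MM' p; rewrite /state_change (bigD1 t) //=.
  have: (\sum_(i | i != t) incidence N p i * (y i)%:Z <= 0)%R.
    apply: sumr_le0 => t' _; rewrite /incidence.
    case: (posnP (y t')) => [->|/nopost->]; first by rewrite mulr0.
    nia.
  rewrite {2}/incidence (nopost t) //; set S := (\sum_(i | _) _)%R; nia.
have [M1 f1] := enabled_fire en.
have [||s f sE] := IH y' M1.
- have : \sum_t y t = \sum_t' (t == t') + \sum_t y' t.
    by rewrite -big_split; apply: eq_bigr => i _; apply: yE.
  by rewrite [X in _ = X + _](bigD1 t) //= eqxx; lia.
- move=> p; rewrite MM' f1.2 (eq_state_change p yE).
  by rewrite state_changeD state_change1 addrA.
exists (t :: s); first by exists M1.
by move=> t'; rewrite /= sE -yE.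
Qed.

(** Each token weighs [B] to the height of its place. If [t] has height [h], an input token weighs
    at least [B ^ h.+1], while the at most [B.-1] output tokens weigh at most [B ^ h] each. *)
Lemma acyclic_weight : (forall t, exists p, 0 < pre N p t) ->
  exists w : marking P -> nat, forall M t M', fire N M t M' -> w M' < w M.
Proof.
move=> preN; pose B := (\sum_t \sum_p post N p t).+1.
pose c p := B ^ height (inl p).
exists (fun M => \sum_p c p * M p) => M t M' [en eM].
have [p0 pre0] := preN t.
have: \sum_p c p * M' p + \sum_p c p * pre N p t
    = \sum_p c p * M p + \sum_p c p * post N p t.
  rewrite -!big_split /=; apply: eq_bigr => p _; rewrite -!mulnDr; congr (_ * _).
  by have := eM p; rewrite /incidence; lia.
suff: \sum_p c p * post N p t < \sum_p c p * pre N p t by lia.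
have le_post : \sum_p c p * post N p t <= B ^ height (inr t) * B.-1.
  apply: (@leq_trans (\sum_p B ^ height (inr t) * post N p t)).
    apply: leq_sum => p _; case: (posnP (post N p t)) => [->|gt0]; first by lia.
    rewrite leq_mul2r leq_pexp2l ?orbT //.
    exact/ltnW/(@height_arc (inr t) (inl p)).
  by rewrite -big_distrr leq_mul2l /= (bigD1 t) //= leq_addr orbT.
have lt_pre : B ^ height (inr t) * B <= \sum_p c p * pre N p t.
  rewrite (bigD1 p0) //=; apply: leq_trans (leq_addr _ _).
  apply: (@leq_trans (c p0)); last by rewrite leq_pmulr.
  rewrite -expnSr leq_pexp2l //.
  exact: (@height_arc (inl p0) (inr t) pre0).
have: 0 < B ^ height (inr t) by rewrite expn_gt0.
move: le_post lt_pre; rewrite /B /=; nia.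
Qed.

End Acyclic.
End Nets.

(** * Explanations and minimax basis markings *)

Section Basis.
Variables (P T : finType) (N : petri_net P T) (TE TI : {set T}).
Hypothesis acI : acyclic_net (induced_subnet N TI).
Hypothesis coverT : TE :|: TI = [set: T].
Implicit Types (M : marking P) (t : trans_in TE) (s : seq (trans_in TI)).

Local Notation NI := (induced_subnet N TI).

Lemma fires_subnet M s M' : fires N M (map val s) M' <-> fires NI M s M'.
Proof.
elim: s M => [|t s IH] M //=.
by split=> -[M1 f1 /IH f]; exists M1.
Qed.

Lemma fires_implicit_state M s M' p : fires N M (map val s) M' ->
  ((M' p)%:Z = (M p)%:Z + state_change NI p (parikh s))%R.
Proof.
move=> /fires_subnet/fires_state->; congr (_ + _)%R.
by apply: eq_state_change => t; rewrite ffunE.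
Qed.

Lemma implicit_reach_state M M' (y : trans_in TI -> nat) :
  (forall p, ((M' p)%:Z = (M p)%:Z + state_change NI p y)%R) ->
  implicit_reach N TI M M'.
Proof. by move=> /(acyclic_fires acI)[s f _]; exists s; apply/fires_subnet. Qed.

Lemma implicit_reach_reachable M M' : implicit_reach N TI M M' -> reachable N M M'.
Proof. by case=> s f; exists (map val s). Qed.

(* The implicit transitions in [s2] but not in [s1] can be postponed until
   after a common change [d]: take [d = 0], or [d] the effect of an explicit
   transition. *)
Lemma implicit_reach_sub M s1 s2 M1 M2 M1' M2' (d : P -> int) :
  vec_le (parikh s1) (parikh s2) ->
  fires N M (map val s1) M1 -> fires N M (map val s2) M2 ->
  (forall p, ((M1' p)%:Z = (M1 p)%:Z + d p)%R) ->
  (forall p, ((M2' p)%:Z = (M2 p)%:Z + d p)%R) ->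
  implicit_reach N TI M1' M2'.
Proof.
move=> le f1 f2 e1 e2.
apply: (@implicit_reach_state _ _ (fun i => parikh s2 i - parikh s1 i)) => p.
rewrite e1 e2 (fires_implicit_state p f1) (fires_implicit_state p f2).
rewrite (@eq_state_change _ _ NI p (parikh s2)
          (fun i => parikh s1 i + (parikh s2 i - parikh s1 i))); last first.
  by move=> i; rewrite subnKC.
by rewrite state_changeD; lia.
Qed.

Lemma parikh_lt_size s1 s2 :
  vec_le (parikh s1) (parikh s2) -> parikh s1 <> parikh s2 -> size s1 < size s2.
Proof.
move=> le ne.
have sizeE s : size s = \sum_i parikh s i.
  rewrite -sum1_size (partition_big id xpredT) //=.
  by apply: eq_bigr => t _; rewrite ffunE -sum1_count.
rewrite !sizeE; have [t lt] : exists i, parikh s1 i < parikh s2 i.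
    apply: NNPP => nlt; case: ne; apply/ffunP => t.
  apply/eqP; rewrite eqn_leq le leqNgt /=; apply/negP => lt.
  by apply: nlt; exists t.
rewrite (bigD1 t) //= [ltnRHS](bigD1 t) //= -addSn.
by apply: leq_add => //; apply: leq_sum => i _; apply: le.
Qed.

Lemma min_explanation_le M t s : explanation N M t s ->
  exists2 s', min_explanation N M t s' & vec_le (parikh s') (parikh s).
Proof.
elim: {s}_.+1 {-2}s (ltnSn (size s)) => // n IH s le_n ex.
case: (classic (exists s', [/\ explanation N M t s', vec_le (parikh s') (parikh s)
                             & parikh s' <> parikh s])) => [[s' [ex' le ne]]|no].
  have [|s2 mx le2] := IH s' _ ex'; first by have := parikh_lt_size le ne; lia.
  by exists s2 => // i; apply: leq_trans (le2 i) (le i).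
by exists s.
Qed.

Variable w : marking P -> nat.
Hypothesis wP : forall M (t : trans_in TI) M', fire NI M t M' -> w M' < w M.

Lemma size_implicit M s M' : fires N M (map val s) M' -> size s <= w M.
Proof.
elim: s M => //= t s IH M [M1 f1 /IH le].
have := @wP M t M1 f1; lia.
Qed.

Lemma max_explanation_ge M t s : explanation N M t s ->
  exists2 s', max_explanation N M t s' & vec_le (parikh s) (parikh s').
Proof.
(* No explanation is longer than [w M], so repeated enlargement of [s] must stop. *)
elim: {s}_.+1 {-2}s (ltnSn (w M - size s)) => // n IH s le_n ex.
case: (classic (exists s', [/\ explanation N M t s', vec_le (parikh s) (parikh s')
                             & parikh s' <> parikh s])) => [[s' [ex' le ne]]|no].
  have [|s2 mx le2] := IH s' _ ex'.
    have := parikh_lt_size le (not_eq_sym ne).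
    have [M' /size_implicit] := ex'; lia.
  by exists s2 => // i; apply: leq_trans (le i) (le2 i).
by exists s.
Qed.

Lemma minimax_stepI M1 t s M M2 :
  min_explanation N M1 t s \/ max_explanation N M1 t s ->
  fires N M1 (map val s) M -> fire N M (val t) M2 ->
  minimax_step N M1 (t, parikh s) M2.
Proof.
move=> mm f [_ e]; split; first by case: mm => ?; [left|right]; exists s.
by move=> p; rewrite e (fires_implicit_state p f).
Qed.

Lemma minimax_step_reachable M1 (e : event TE TI) M2 :
  minimax_step N M1 e M2 -> reachable N M1 M2.
Proof.
case: e => t y [mm /= eM].
have [s [[M f en] yE]] : exists s, explanation N M1 t s /\ parikh s = y.
  by case: mm => -[s [ex _] e]; exists s.
exists (map val s ++ [:: val t]); apply/fires_cat; exists M => //.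
apply/fires1; split=> // p.
by rewrite eM (fires_implicit_state p f) yE.
Qed.

Lemma minimax_basis_reachable M0 M :
  minimax_basis N TE TI M0 M -> reachable N M0 M.
Proof.
elim=> [|M1 e M2 _ r1 /minimax_step_reachable]; first exact: reachable_refl.
exact: reachable_trans.
Qed.

Lemma run_reachable M0 M1 es M2 :
  run (minimax_BRG N TE TI M0) M1 es M2 -> reachable N M1 M2.
Proof.
elim: es M1 => [|e es IH] M1 /=; first by move->; apply: reachable_refl.
case=> M [_ /minimax_step_reachable r] /IH; exact: reachable_trans.
Qed.

Lemma explicit_or_implicit (u : T) :
  (exists t : trans_in TE, val t = u) \/ (exists t : trans_in TI, val t = u).
Proof.
have: u \in TE :|: TI by rewrite coverT inE.
by case/setUP => uA; [left|right]; exists (exist _ u uA).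
Qed.

(** Invariant: the current marking stays in the implicit reach of the current basis marking. An
    implicit transition extends the pending sequence [s0]; an explicit one advances the basis
    marking by a minimal explanation below [s0], and the rest of [s0] stays pending. *)
Lemma basis_follow M0 Mb M M' :
  minimax_basis N TE TI M0 Mb -> implicit_reach N TI Mb M -> reachable N M M' ->
  exists Mb', [/\ minimax_basis N TE TI M0 Mb',
    exists es, run (minimax_BRG N TE TI M0) Mb es Mb' & implicit_reach N TI Mb' M'].
Proof.
move=> + + [us]; elim: us Mb M => [|u us IH] Mb M bMb [s0 f0] /=.
  by move=> <-; exists Mb; split=> //; [exists [::]|exists s0].
case=> M1 fu fus.
case: (explicit_or_implicit u) => -[t tu]; rewrite -{}tu in fu; last first.
  apply: IH fus => //; exists (s0 ++ [:: t]).
  by rewrite map_cat; apply/fires_cat; exists M => //; apply/fires1.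
have ex0 : explanation N Mb t s0 by exists M => //; case: fu.
have [s mx le] := min_explanation_le ex0.
have [[M2 f2 /enabled_fire[Mb1 f3]] _] := mx.
have step := minimax_stepI (or_introl mx) f2 f3.
have r1 := implicit_reach_sub le f2 f0 f3.2 fu.2.
have [Mb' [b' [es res] i']] := IH _ _ (minimax_basis_step bMb step) r1 fus.
exists Mb'; split=> //; exists ((t, parikh s) :: es).
by exists Mb1.
Qed.

(** A maximal explanation dominating [s0] leads to a marking still ahead of [M], whereas a minimal
    one may already have been overshot. *)
Lemma explicit_reach_basis M0 M t : reachable N M0 M -> enabled N M (val t) ->
  exists2 Mb, minimax_basis N TE TI M0 Mb & reachable N M Mb.
Proof.
have self : implicit_reach N TI M0 M0 by exists [::].
move=> /(basis_follow (minimax_basis_init _ _ _ _) self)[Mb [bMb _ [s0 f0]]] en.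
have [s mx le] := @max_explanation_ge Mb t s0 (ex_intro2 _ _ M f0 en).
have [[M1 f1 /enabled_fire[Mb1 f2]] _] := mx.
exists Mb1; first by apply: minimax_basis_step bMb (minimax_stepI (or_intror mx) f1 f2).
apply: (@reachable_trans _ _ _ M1); last exact: fire_reachable f2.
apply: implicit_reach_reachable.
by apply: (implicit_reach_sub (d := fun=> 0%R) le f0 f1) => p; rewrite addr0.
Qed.

End Basis.

Theorem theorem2 (P T : finType) (G : plant P T) (TE TI : {set T})
    (Gbounded : bounded_plant G)
    (piP : basis_partition (plant_net G) TE TI)
    (* no implicit transition has both an empty preset and an empty postset *)
    (TInot_isolated : forall t, t \in TI -> ~ isolated (plant_net G) t) :
  nonblocking G <->
  unobstructed (plant_net G) (plant_final G)
    (minimax_BRG (plant_net G) TE TI (plant_init G)) /\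
  (forall M, reachable (plant_net G) (plant_init G) M ->
     dead (plant_net G) M -> plant_final G M).
Proof.
case: piP => coverT _ acI.
have [w wP] : exists w : marking P -> nat, forall M t M',
    fire (induced_subnet (plant_net G) TI) M t M' -> w M' < w M.
  apply: acyclic_weight => // t.
  apply: (bounded_pre_nonempty Gbounded).
  exact/TInot_isolated/valP.
split=> [nb|[unob deadF] M].
  split=> [Mb bMb|M /nb[M' [[|t s] /= f] F] dM]; last 2 first.
  (* Only the empty sequence fires from a dead marking, so the final marking it reaches is
     itself. *)
  - by rewrite f.
  - by case: f => M1 [/dM].
  have [M' r F] := nb _ (minimax_basis_reachable bMb).
  have self : implicit_reach (plant_net G) TI Mb Mb by exists [::].
  have [Mb' [b' rn i']] := basis_follow acI coverT bMb self r.
  by exists Mb' => //; split=> //; exists M'.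
(* The induction on the weight serves the case of an implicit [u]; an explicit [u] leads to a basis
   marking, where [unob] applies. *)
elim: {M}_.+1 {-2}M (ltnSn (w M)) => // n IH M le_n rM.
case: (classic (dead (plant_net G) M)) => [dM|].
  by exists M; [exact: reachable_refl|exact: deadF].
move=> /not_all_ex_not[u /NNPP en].
case: (explicit_or_implicit coverT u) => -[t tu]; rewrite -{}tu in en.
  have [Mb bMb rMb] := explicit_reach_basis acI coverT wP rM en.
  have [Mb' [_ [M' iM' FM']] [es /run_reachable r]] := unob _ bMb.
  exists M' => //; apply: reachable_trans rMb _; apply: reachable_trans r _.
  exact: implicit_reach_reachable iM'.
have [M1 f1] := enabled_fire en.
have r1 := fire_reachable f1.
have [||M' r F] := IH M1.
- have := wP M t M1 f1; lia.
- exact: reachable_trans r1.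
by exists M' => //; apply: reachable_trans r1 r.
Qed.
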